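(* The satisfiability problem of the first-order existential theory $T_S$ is undecidable.
   Context: $T_S$ denotes the existential first-order two-sorted theory with sorts $str$ (strings over a finite alphabet containing the symbols $0$ and $1$) and $nat$ (natural numbers), consisting of string (word) equations, i.e. equalities between concatenations of string constants and string variables; a length function $len$ from strings to numbers; linear arithmetic over numbers; and a string-number conversion predicate $strnum(z,x)$, which is true, for a binary string $z$ and a number $x$, if and only if $z$ is the binary representation of $x$. *)

(* Defs.v *)
From mathcomp Require Import all_boot.

Set Implicit Arguments.
Unset Strict Implicit.
Unset Printing Implicit Defensive.

(* String variables and number variables are two disjoint families, each
   indexed by nat. *)
Section Syntax.
Variable Sigma : finType.

Inductive sterm :=
  | SVar (i : nat)
  | SConst (w : seq Sigma)
  | SCat (s t : sterm).

(* Linear: multiplication is only by a numeral. *)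
Inductive nterm :=
  | NVar (i : nat)
  | NConst (n : nat)
  | NLen (s : sterm)
  | NAdd (u v : nterm)
  | NScale (k : nat) (u : nterm).

Inductive qform :=
  | WordEq (s t : sterm)
  | NatEq (u v : nterm)
  | NatLe (u v : nterm)
  | StrNum (s : sterm) (u : nterm)
  | Not (p : qform)
  | And (p q : qform)
  | Or (p q : qform).

(* Prenex existential formulas, possibly with free variables. *)
Inductive eform :=
  | Matrix (p : qform)
  | ExStr (i : nat) (e : eform)
  | ExNat (i : nat) (e : eform).

End Syntax.

Arguments SVar {Sigma} i.
Arguments NVar {Sigma} i.
Arguments NConst {Sigma} n.

Definition upd (T : Type) (f : nat -> T) (i : nat) (a : T) : nat -> T :=
  fun j => if j == i then a else f j.

(* Most significant digit first. *)
Definition binval (b : seq bool) : nat := foldl (fun v (d : bool) => v.*2 + d) 0 b.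

(* No leading zeros, the number 0 being written with the single digit 0. *)
Definition canonical (b : seq bool) : bool := (b == [:: false]) || head false b.

Section Semantics.
Variables (Sigma : finType) (c0 c1 : Sigma).

Definition strnum (z : seq Sigma) (x : nat) : Prop :=
  exists b : seq bool,
    [/\ canonical b, z = [seq (if d then c1 else c0) | d <- b] & binval b = x].

Fixpoint seval (sv : nat -> seq Sigma) (s : sterm Sigma) : seq Sigma :=
  match s with
  | SVar i => sv i
  | SConst w => w
  | SCat s t => seval sv s ++ seval sv t
  end.

Fixpoint neval (sv : nat -> seq Sigma) (nv : nat -> nat) (u : nterm Sigma) : nat :=
  match u with
  | NVar i => nv i
  | NConst n => n
  | NLen s => size (seval sv s)
  | NAdd u v => neval sv nv u + neval sv nv v
  | NScale k u => k * neval sv nv u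
  end.

Fixpoint qholds (sv : nat -> seq Sigma) (nv : nat -> nat) (p : qform Sigma) : Prop :=
  match p with
  | WordEq s t => seval sv s = seval sv t
  | NatEq u v => neval sv nv u = neval sv nv v
  | NatLe u v => neval sv nv u <= neval sv nv v
  | StrNum s u => strnum (seval sv s) (neval sv nv u)
  | Not p => ~ qholds sv nv p
  | And p q => qholds sv nv p /\ qholds sv nv q
  | Or p q => qholds sv nv p \/ qholds sv nv q
  end.

Fixpoint eholds (sv : nat -> seq Sigma) (nv : nat -> nat) (e : eform Sigma) : Prop :=
  match e with
  | Matrix p => qholds sv nv p
  | ExStr i e => exists w : seq Sigma, eholds (upd sv i w) nv e
  | ExNat i e => exists n : nat, eholds sv (upd nv i n) e
  end.

Definition satisfiable (e : eform Sigma) : Prop :=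
  exists (sv : nat -> seq Sigma) (nv : nat -> nat), eholds sv nv e.

End Semantics.

Section Coding.
Variable Sigma : finType.

Definition code_word (w : seq Sigma) : nat :=
  CodeSeq.code [seq nat_of_ord (enum_rank a) | a <- w].

Fixpoint code_sterm (s : sterm Sigma) : nat :=
  match s with
  | SVar i => CodeSeq.code [:: 0; i]
  | SConst w => CodeSeq.code [:: 1; code_word w]
  | SCat s t => CodeSeq.code [:: 2; code_sterm s; code_sterm t]
  end.

Fixpoint code_nterm (u : nterm Sigma) : nat :=
  match u with
  | NVar i => CodeSeq.code [:: 0; i]
  | NConst n => CodeSeq.code [:: 1; n]
  | NLen s => CodeSeq.code [:: 2; code_sterm s]
  | NAdd u v => CodeSeq.code [:: 3; code_nterm u; code_nterm v]
  | NScale k u => CodeSeq.code [:: 4; k; code_nterm u]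
  end.

Fixpoint code_qform (p : qform Sigma) : nat :=
  match p with
  | WordEq s t => CodeSeq.code [:: 0; code_sterm s; code_sterm t]
  | NatEq u v => CodeSeq.code [:: 1; code_nterm u; code_nterm v]
  | NatLe u v => CodeSeq.code [:: 2; code_nterm u; code_nterm v]
  | StrNum s u => CodeSeq.code [:: 3; code_sterm s; code_nterm u]
  | Not p => CodeSeq.code [:: 4; code_qform p]
  | And p q => CodeSeq.code [:: 5; code_qform p; code_qform q]
  | Or p q => CodeSeq.code [:: 6; code_qform p; code_qform q]
  end.

Fixpoint code_eform (e : eform Sigma) : nat :=
  match e with
  | Matrix p => CodeSeq.code [:: 0; code_qform p]
  | ExStr i e => CodeSeq.code [:: 1; i; code_eform e]
  | ExNat i e => CodeSeq.code [:: 2; i; code_eform e]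
  end.

Let code_inj : injective CodeSeq.code := can_inj CodeSeq.codeK.

Lemma code_word_inj : injective code_word.
Proof.
by move=> w w' /code_inj; apply: inj_map => a b /val_inj /enum_rank_inj.
Qed.

Lemma code_sterm_inj : injective code_sterm.
Proof.
elim=> [i|w|s IHs t IHt] [i'|w'|s' t'] /code_inj // [].
- by move=> ->.
- by move=> /code_word_inj ->.
- by move=> /IHs -> /IHt ->.
Qed.

Lemma code_nterm_inj : injective code_nterm.
Proof.
elim=> [i|n|s|u IHu v IHv|k u IHu] [i'|n'|s'|u' v'|k' u'] /code_inj // [].
- by move=> ->.
- by move=> ->.
- by move=> /code_sterm_inj ->.
- by move=> /IHu -> /IHv ->.
- by move=> -> /IHu ->.
Qed.

Lemma code_qform_inj : injective code_qform.
Proof.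
elim=> [s t|u v|u v|s u|p IHp|p IHp q IHq|p IHp q IHq]
       [s' t'|u' v'|u' v'|s' u'|p'|p' q'|p' q'] /code_inj // [].
- by move=> /code_sterm_inj -> /code_sterm_inj ->.
- by move=> /code_nterm_inj -> /code_nterm_inj ->.
- by move=> /code_nterm_inj -> /code_nterm_inj ->.
- by move=> /code_sterm_inj -> /code_nterm_inj ->.
- by move=> /IHp ->.
- by move=> /IHp -> /IHq ->.
- by move=> /IHp -> /IHq ->.
Qed.

Lemma code_eform_inj : injective code_eform.
Proof.
elim=> [p|i e IHe|i e IHe] [p'|i' e'|i' e'] /code_inj // [].
- by move=> /code_qform_inj ->.
- by move=> -> /IHe ->.
- by move=> -> /IHe ->.
Qed.

End Coding.

(* Minsky register machines with arbitrarily many registers; these compute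
   exactly the partial recursive functions. *)
(* Inc r: increment register r, go to the next instruction.
   Dec r l: if register r is 0 then jump to instruction l, otherwise decrement
   it and go to the next instruction. *)
Inductive instr :=
  | Inc (r : nat)
  | Dec (r l : nat).

Definition config := (nat * (nat -> nat))%type.

(* A machine has halted once its program counter is outside the program; a    *)
(* halted configuration is a fixed point of step.                             *)
Definition step (P : seq instr) (c : config) : config :=
  let: (pc, R) := c in
  match onth P pc with
  | None => c
  | Some (Inc r) => (pc.+1, upd R r (R r).+1)
  | Some (Dec r l) =>
      if R r is n.+1 then (pc.+1, upd R r n) else (l, R)
  end.

Definition init (x : nat) : config := (0, fun r => if r == 0 then x else 0).

Definition computes (P : seq instr) (x y : nat) : Prop :=
  exists n : nat,
    let c := iter n (step P) (init x) in size P <= c.1 /\ c.2 0 = y.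

Definition decidable_problem (T : Type) (code : T -> nat) (A : T -> Prop) : Prop :=
  exists P : seq instr, forall x : T,
    (A x -> computes P (code x) 1) /\ (~ A x -> computes P (code x) 0).

(* Main.v *)
Require Import Defs.
From mathcomp Require Import all_boot zify.
From Stdlib Require Import FunctionalExtensionality.

Set Implicit Arguments.
Unset Strict Implicit.
Unset Printing Implicit Defensive.

(* Padding a numeral with zeros makes [z = x 2^y] existentially definable.
   Then so is [b = a m] for small [m], since [u (2^a - 1) = 2^b - 1] forces
   [u = 1 + 2^a + ... + 2^(a (m - 1))], which is congruent to [m] modulo
   [2^a - 1]; hence multiplication is definable, and with it exponentiation (as
   a remainder of a power of 2), binomial coefficients (as digits of
   [(B + 1)^n]) and digitwise comparison in base 2 (by Lucas' theorem). As in
   the proof of Jones and Matiyasevich that exponential Diophantine problems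
   are undecidable, this suffices to say that a given register machine halts,
   the history of each register being coded by the digits of one number.

   If [P] decided satisfiability, let [D] be the machine that on input [n], the
   code of a formula [p], runs [P] on the formula [p /\ x = n] and halts iff
   the answer is 0. Taking for [p] a definition of "[D] halts on [x]" gives a
   contradiction. *)

(** * Arithmetic *)

Lemma binval_cat_zeros b y : binval (b ++ nseq y false) = binval b * 2 ^ y.
Proof.
rewrite /binval foldl_cat; elim: y (foldl _ _ b) => [|y IHy] x /=.
  by rewrite muln1.
by rewrite IHy addn0 expnS -muln2 mulnA.
Qed.

Lemma binval_surj n : exists2 b, head false b & binval b = n.+1.
Proof.
elim/ltn_ind: n => -[|n] IHn; first by exists [:: true].
have ltn : n./2 < n.+1 by lia.
have [b hb bn] := IHn _ ltn.
exists (rcons b (odd n)); first by case: b hb bn.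
by rewrite /binval -cats1 foldl_cat -/(binval b) bn /=; lia.
Qed.

(** This is how a word equation will say that a string consists of zeros only. *)
Lemma commute_letter_nseq (T : Type) (a : T) s :
  s ++ [:: a] = a :: s -> s = nseq (size s) a.
Proof. by elim: s => //= x s IHs [-> /IHs {1}->]. Qed.

(* [u] is [1 + 2^a + ... + 2^(a (k - 1))] with [b = a k], and it is congruent
   to [k] modulo [2^a - 1]. *)
Definition small_product a m b :=
  b.+1 < 2 ^ a /\ m.+1 < 2 ^ a /\
  exists u t, u * 2 ^ a + 1 = u + 1 * 2 ^ b /\ u + t = m + t * 2 ^ a.

Lemma succ_exp N i : exists w, N.+1 ^ i = 1 + N * w.
Proof.
exists (\sum_(j < i) N.+1 ^ j); have := predn_exp N.+1 i => /= <-.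
by rewrite add1n prednK ?expn_gt0.
Qed.

(** Each summand is 1 modulo [N]. The quotient [w] is made explicit because it becomes the witness
    [t] of [small_product]. *)
Lemma geometric_sum_mod N k : exists w, \sum_(i < k) N.+1 ^ i = k + N * w.
Proof.
elim: k => [|k [w IHk]]; first by exists 0; rewrite big_ord0 muln0.
have [w' Ew'] := succ_exp N k.
by exists (w + w'); rewrite big_ord_recr /= IHk Ew'; lia.
Qed.

(** Powers of 2 have period [a] modulo [2 ^ a - 1], so the first equation forces [a] to divide [b]
    and [u] to be the geometric sum with [k = b / a] terms. By the second equation [m] is congruent
    to [k], and both are below the modulus. *)
Lemma small_productP a m b : small_product a m b -> b = a * m.
Proof.
move=> [ltb [ltm [u [t [Eu Et]]]]].
case EN: (2 ^ a) => [|N]; first by have := expn_gt0 2 a; rewrite EN.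
rewrite EN in ltb ltm Eu Et.
have a_gt0 : 0 < a by case: (a) EN ltb => // -[<-].
pose k := b %/ a; pose S := \sum_(i < k) N.+1 ^ i.
have Eb : 2 ^ b = (1 + N * S) * 2 ^ (b %% a).
  rewrite {1}(divn_eq b a) mulnC expnD expnM EN -[N * S](predn_exp N.+1).
  by rewrite add1n prednK ?expn_gt0.
have ltr : 2 ^ (b %% a) <= N by rewrite -ltnS -EN ltn_exp2l // ltn_mod.
have Er : 2 ^ (b %% a) = 1.
  have := expn_gt0 2 (b %% a); move: ltr Eb; set r := 2 ^ _ => ltr Eb r_gt0.
  have E : u * N + 1 = r + N * (S * r) by lia.
  have : (u * N + 1) %% N = (r + N * (S * r)) %% N by rewrite E.
  rewrite modnMDl [N * _]mulnC addnC modnMDl.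
  case: (ltngtP r N) ltr => // [ltr _|-> _].
    by rewrite (modn_small ltr); case: (N) ltr => [|[|N']] //; lia.
  by rewrite modnn; case: (N) => [|[|]].
have b_eq : b = a * k.
  have : b %% a = 0 by apply/eqP; rewrite -(@eqn_exp2l 2) // Er.
  by rewrite {2}(divn_eq b a) mulnC => ->; rewrite addn0.
have E1 : u = S by move: Eb; rewrite Er; nia.
have [w Ew] := geometric_sum_mod N k.
have : (t * N + m) %% N = (w * N + k) %% N by congr (_ %% _); rewrite /S in E1; lia.
rewrite !modnMDl !modn_small; [by rewrite b_eq => ->|nia|lia].
Qed.

Lemma small_product_mul a m :
  (a * m).+1 < 2 ^ a -> m.+1 < 2 ^ a -> small_product a m (a * m).
Proof.
move=> ltb ltm; split=> //; split=> //.
case EN: (2 ^ a) => [|N]; first by have := expn_gt0 2 a; rewrite EN.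
exists (\sum_(i < m) N.+1 ^ i); have [w Ew] := geometric_sum_mod N m.
exists w; split; last by rewrite Ew; lia.
have := predn_exp N.+1 m; rewrite expnM EN /=.
have : 0 < N.+1 ^ m by rewrite expn_gt0.
set S := \sum_(_ < _) _; set T := _ ^ _; rewrite mulnS mulnC; lia.
Qed.

Lemma sqr_le_pow2 n : 4 <= n -> n * n <= 2 ^ n.
Proof.
elim: n => // n IHn; rewrite ltnS leq_eqVlt => /predU1P[<- //|le4n].
by move: (IHn le4n); rewrite expnS; set p := expn _ _; nia.
Qed.

(** [small_product] needs a large first factor, so [x m] is obtained as the difference of
    [(x + c) m] and [c m] for a large shift [c]. *)
Lemma mul_small_product x m z :
  z = x * m <->
  exists c b1 b2, z + b1 = b2 /\ (small_product c m b1 /\ small_product (x + c) m b2).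
Proof.
split=> [->|[c [b1 [b2 [E [/small_productP E1 /small_productP E2]]]]]]; last first.
  by move: E; rewrite E1 E2; lia.
(* Here [a m + 1 < a ^ 2 <= 2 ^ a], so [m + 4] is a sufficient shift. *)
have P a : m + 4 <= a -> small_product a m (a * m).
  move=> le_a; have := @sqr_le_pow2 a ltac:(lia).
  by move=> h; apply: small_product_mul; nia.
exists (m + 4), ((m + 4) * m), ((x + (m + 4)) * m); split; first by lia.
by split; apply: P; lia.
Qed.

(** With [k = x n + x + 1] and [M = 2 ^ k - x], the power [2 ^ k] is congruent to [x] modulo [M],
    hence [2 ^ (k n)] to [x ^ n]; and [k] is large enough for [x ^ n < M]. *)
Lemma exp_remainder x n r :
  r = x ^ n <->
  exists M w, M + x = 2 ^ (x * n + x + 1) /\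
    (r.+1 <= M /\ 2 ^ ((x * n + x + 1) * n) = w * M + r).
Proof.
set k := x * n + x + 1.
have ltX : x ^ n + x < 2 ^ k.
  have le1 : x ^ n <= 2 ^ (x * n).
    by rewrite expnM; case: n {k} => // n; rewrite leq_exp2r // ltnW // ltn_expl.
  have lt2 : x < 2 ^ x by apply: ltn_expl.
  have : 0 < 2 ^ (x * n) by rewrite expn_gt0.
  rewrite /k !expnD; move: le1 lt2.
  by set a := x ^ n; set b := 2 ^ _; set c := 2 ^ _; nia.
have modM M : M + x = 2 ^ k -> 2 ^ (k * n) = x ^ n %[mod M].
  by move=> EM; rewrite expnM -EM -modnXm modnDl modnXm.
split=> [->|[M [w [EM [ltr Ew]]]]].
  exists (2 ^ k - x), (2 ^ (k * n) %/ (2 ^ k - x)).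
  split; first by lia.
  split; first by lia.
  rewrite {1}(divn_eq (2 ^ (k * n)) (2 ^ k - x)) (@modM (2 ^ k - x)); last by lia.
  by rewrite [x ^ n %% _]modn_small //; lia.
have := modM M EM; rewrite Ew modnMDl !modn_small //; lia.
Qed.

(** * Binomial coefficients as digits, and digitwise comparison *)

Lemma digit_sum (B : nat) (f : nat -> nat) N k :
  (forall i, f i < B) -> k < N ->
  (\sum_(i < N) f i * B ^ i) %/ B ^ k %% B = f k.
Proof.
elim: k N f => [|k IHk] [//|N] f ltf; rewrite ltnS => ltk;
  have B_gt0 : 0 < B by apply: leq_ltn_trans (ltf 0).
all: have -> : \sum_(i < N.+1) f i * B ^ i = (\sum_(i < N) f i.+1 * B ^ i) * B + f 0.
1,3: rewrite big_ord_recl muln1 addnC; congr (_ + _); rewrite big_distrl.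
1,2: by apply: eq_bigr => i _; rewrite /= expnSr mulnA.
- by rewrite divn1 modnMDl modn_small.
- rewrite expnS divnMA divnMDl // (divn_small (ltf 0)) addn0.
  by apply: (IHk _ (f \o succn)) => // i; apply: ltf.
Qed.

Lemma bin_le_pow2 n k : 'C(n, k) <= 2 ^ n.
Proof.
elim: n k => [|n IHn] [|k]; rewrite ?bin0 ?expn_gt0 //.
by rewrite binS expnS mul2n -addnn leq_add.
Qed.

(* By Lucas' theorem, the binary digits of [a] are bounded by those of [b]. *)
Definition bitle (a b : nat) : bool := odd 'C(b, a).

(** [B] exceeds every binomial coefficient of row [b], so these are the base [B] digits of
    [(B + 1) ^ b]. The digit at place [a] is written as the odd number [2 d + 1]; [h] and [l]
    collect the digits above and below it. *)
Lemma bitle_digit a b :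
  bitle a b <->
  a <= b /\ exists B, B = 2 ^ b.+1 /\ exists h d l,
    B.+1 ^ b = (h * B + (2 * d).+1) * B ^ a + l /\ (l < B ^ a /\ (2 * d).+1 < B).
Proof.
have ltB i : 'C(b, i) < 2 ^ b.+1.
  by apply: leq_ltn_trans (bin_le_pow2 b i) _; rewrite ltn_exp2l.
have EB B : B = 2 ^ b.+1 -> a <= b -> B.+1 ^ b %/ B ^ a %% B = 'C(b, a).
  move=> EB leab; rewrite -[RHS](@digit_sum B (fun i => 'C(b, i)) b.+1) ?EB //.
  congr (_ %/ _ %% _); rewrite -add1n expnDn; apply: eq_bigr => i _.
  by rewrite exp1n mul1n.
rewrite /bitle; split=> [oddC|[leab [B [EB2 [h [d [l [E [ltl ltd]]]]]]]]].
- have leab : a <= b by rewrite leqNgt; apply: contraL oddC => /bin_small ->.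
  split=> //; exists (2 ^ b.+1); split=> //; set B := 2 ^ _.
  exists (B.+1 ^ b %/ B ^ a %/ B), ('C(b, a)./2), (B.+1 ^ b %% B ^ a).
  have -> : (2 * 'C(b, a)./2).+1 = 'C(b, a).
    by rewrite -[RHS]odd_double_half oddC mul2n.
  split; first by rewrite -[X in (_ + X) * _](EB B erefl leab) -!divn_eq.
  by split=> //; rewrite ltn_mod !expn_gt0.
- rewrite -(EB B EB2 leab) E divnMDl; last by rewrite EB2 !expn_gt0.
  by rewrite (divn_small ltl) addn0 modnMDl modn_small //= oddM.
Qed.

(** Modulo 2, [(1 + X) ^ (2 n)] is [(1 + X ^ 2) ^ n]. The induction applies Pascal's rule twice. *)
Lemma odd_bin_double n k :
  (odd 'C(n.*2, k.*2) = odd 'C(n, k)) * (odd 'C(n.*2, k.*2.+1) = false).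
Proof.
elim: n k => [|n IHn] k; first by case: k => [|k] //; rewrite doubleS !bin0n.
rewrite doubleS; split; last first.
  case: k => [|k]; first by rewrite bin1 /= odd_double.
  by rewrite doubleS !binS !oddD -!doubleS !IHn addbF addFb addbb.
case: k => [|k]; first by rewrite !bin0.
by rewrite doubleS !binS !oddD -doubleS !IHn addbF addFb.
Qed.

Lemma bitle_bit a b (d e : bool) :
  bitle (a.*2 + d) (b.*2 + e) = (d <= e) && bitle a b.
Proof.
rewrite /bitle; case: d e => -[]; rewrite ?addn0 ?addn1 ?odd_bin_double //.
  by rewrite binS oddD !odd_bin_double.
by case: a => [|a]; rewrite ?bin0 // doubleS binS oddD -doubleS !odd_bin_double addbF.
Qed.

Lemma bitle_leq a b : bitle a b -> a <= b.
Proof. by rewrite leqNgt; apply: contraL => lt_ba; rewrite /bitle bin_small. Qed.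

(** Iterating [bitle_bit] lets histories be handled one base [2 ^ q] digit at a time. *)
Lemma bitle_digits q a b A B : a < 2 ^ q -> b < 2 ^ q ->
  bitle (a + 2 ^ q * A) (b + 2 ^ q * B) = bitle a b && bitle A B.
Proof.
elim: q a b => [|q IHq] a b.
  by rewrite !ltnS !leqn0 => /eqP-> /eqP->; rewrite !mul1n.
rewrite expnS => lta ltb.
have split_bit x X : x + 2 * 2 ^ q * X = (x./2 + 2 ^ q * X).*2 + odd x.
  by rewrite -{1}(odd_double_half x); lia.
have half_bit x : x = x./2.*2 + odd x by rewrite addnC odd_double_half.
rewrite !split_bit bitle_bit IHq; [|lia|lia].
by rewrite andbA -bitle_bit -!half_bit.
Qed.

(** All [q] binary digits of [2 ^ q - 1] are 1. Together with [bitle_leq], comparison with this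
    number is just a bound on [a]. *)
Lemma bitle_full q a : a < 2 ^ q -> bitle a (2 ^ q).-1.
Proof.
elim: q a => [|q IHq] a; first by rewrite ltnS leqn0 => /eqP->.
rewrite expnS => lta.
have -> : (2 * 2 ^ q).-1 = (2 ^ q).-1.*2 + true by have := expn_gt0 2 q; lia.
rewrite -(odd_double_half a) addnC bitle_bit IHq ?andbT; first by case: odd.
by lia.
Qed.

(** * Arithmetization of runs *)

Definition dot (M : nat) (c X : nat -> nat) : nat := \sum_(0 <= e < M) c e * X e.

Lemma dot_digits M c x X Q :
  dot M c (fun e => x e + Q * X e) = dot M c x + Q * dot M c X.
Proof.
rewrite /dot big_distrr -big_split; apply: eq_bigr => e _ /=.
by rewrite mulnDr mulnCA.
Qed.

Lemma eq_dot M c X Y : (forall e, e < M -> X e = Y e) -> dot M c X = dot M c Y.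
Proof. by move=> eqXY; apply: eq_big_nat => e /andP[_ /eqXY ->]. Qed.

Lemma dot_pred1 M c e0 : e0 < M -> dot M c (fun e => e == e0) = c e0.
Proof.
move=> lte0; rewrite /dot big_mkord (bigD1 (Ordinal lte0)) //= eqxx muln1.
rewrite big1 ?addn0 // => e; rewrite -val_eqE /= => /negbTE ->.
by rewrite muln0.
Qed.

(** Used to extract the one transition that fires at a given time. *)
Lemma dot1_eq1 M x : dot M (fun=> 1) x = 1 ->
  exists2 e0, e0 < M & forall e, e < M -> x e = (e == e0).
Proof.
elim: M => [|M IHM]; first by rewrite /dot big_geq.
rewrite /dot big_nat_recr //= mul1n -/(dot _ _ _).
case Ex: (x M) => [|[|n]] Ed; last by lia.
  have [e0 lte0 xe0] := IHM ltac:(lia); exists e0 => [|e]; first exact: ltnW.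
  rewrite ltnS leq_eqVlt => /predU1P[->|/xe0 //].
  by rewrite Ex gtn_eqF.
exists M => // e; rewrite ltnS leq_eqVlt => /predU1P[->|lte].
  by rewrite Ex eqxx.
rewrite (ltn_eqF lte) /=; move: Ed; rewrite /dot (big_nat _ _ _) /=.
rewrite big_mkord (bigD1 (Ordinal lte)) //=; lia.
Qed.

Lemma base_digit_inj Q a b A B : a < Q -> b < Q ->
  a + Q * A = b + Q * B -> a = b /\ A = B.
Proof.
move=> lta ltb E; have Eab : a = b.
  have := congr1 (modn^~ Q) E.
  by rewrite /= -!(addnC (Q * _)) ![Q * _]mulnC !modnMDl !modn_small.
split=> //; move: E; rewrite Eab => /addnI /eqP; rewrite eqn_mul2l.
by case: (Q) ltb => // Q' _ /eqP.
Qed.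

(** The number with [s] digits 1 in base [Q]. *)
Fixpoint repunit (Q s : nat) : nat := if s is s'.+1 then 1 + Q * repunit Q s' else 0.

(** The closed form [(Q ^ s - 1) / (Q - 1)], freed of subtraction and division. *)
Lemma repunitP Q s I : 1 < Q -> I * Q + 1 = I + Q ^ s <-> I = repunit Q s.
Proof.
move=> Q_gt1; have E : repunit Q s * Q + 1 = repunit Q s + Q ^ s.
  elim: s => [|s /= IHs]; first by rewrite /= mul0n.
  by rewrite expnS; nia.
split=> [EI|-> //].
have: (Q ^ s).-1 = I * Q.-1 by nia.
have -> : (Q ^ s).-1 = repunit Q s * Q.-1 by nia.
by move/eqP; rewrite eqn_mul2r; case: (Q) Q_gt1 => [|[|?]] // _ /eqP.
Qed.

(* Transition [e] of the net goes from control state [src e] to [tgt e]; only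
   the counters [j < J] are constrained. *)
Section Net.
Variables (M J : nat) (src tgt : nat -> nat) (inc dec zero : nat -> nat -> bool).

(** As the decrement is added to the new value, a mere decrement cannot fire at a counter that is
    0. *)
Definition fires (e : nat) (r r' : nat -> nat) : Prop :=
  forall j, j < J -> r' j + dec e j = r j + inc e j /\ (zero e j -> r j = 0).

Fixpoint run (s pc : nat) (r : nat -> nat) (h : nat) : Prop :=
  if s is s'.+1 then
    exists e, [/\ e < M, pc = src e & exists2 r', fires e r r' & run s' (tgt e) r' h]
  else pc = h.

(* The [s] base [2 ^ p.+1] digits of [X e] tell at which times [e] fires, those
   of [R j] and [R' j] are the values of counter [j] before and after each
   step. Counters stay below [2 ^ p], so that no carry ever occurs. *)
Definition history p s pc r h X R R' F : Prop :=
  let Q := 2 ^ p.+1 in let N := (2 ^ p).-1 in let I := repunit Q s in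
  (forall e, e < M -> bitle (X e) I) /\ (dot M (fun=> 1) X = I) /\
  pc + Q * dot M tgt X = dot M src X + Q ^ s * h /\
  forall j, j < J ->
    bitle (R j) (N * I) /\ bitle (R' j) (N * I) /\
    R' j + dot M (dec^~ j) X = R j + dot M (inc^~ j) X /\
    r j + Q * R' j = R j + Q ^ s * F j /\
    forall e, e < M -> zero e j -> bitle (R j + N * X e) (N * I).

(** Induction on [s], removing the lowest digit of every number. Without carries each equation
    splits in two: the lowest digits describe the first step, and the others form a history of the
    remaining steps. *)
Lemma history_run p s pc r h X R R' F :
  (forall e, e < M -> src e < 2 ^ p.+1 /\ tgt e < 2 ^ p.+1) -> M < 2 ^ p.+1 ->
  pc < 2 ^ p.+1 -> (forall j, j < J -> r j < 2 ^ p.+1) ->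
  history p s pc r h X R R' F -> run s pc r h.
Proof.
move=> lt_const ltM; have := expn_gt0 2 p; rewrite /history.
set N := (2 ^ p).-1; rewrite orTb => p_gt0.
(* Two digits bounded by [N], or one such digit and 1, add up without carry in base [Q]. *)
have Q_def : 2 ^ p.+1 = (N + N).+2 by rewrite expnS /N; lia.
have Q_gt0 : 0 < 2 ^ p.+1 by rewrite Q_def.
have bitleQ := @bitle_digits p.+1.
move: lt_const ltM bitleQ; set Q := 2 ^ p.+1 in Q_def Q_gt0 * => lt_const ltM bitleQ.
elim: s pc r X R R' => [|s IHs] pc r X R R' lt_pc lt_r /=.
  move=> [_ [dot0 [E _]]].
  have X0 e : e < M -> X e = 0.
    move=> lte; move: dot0; rewrite /dot big_mkord (bigD1 (Ordinal lte)) //=; lia.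
  have D c : dot M c X = 0.
    by rewrite /dot big_nat big1 // => e /andP[_ /X0 ->]; rewrite muln0.
  by move: E; rewrite !D muln0 addn0 mul1n.
set I := repunit Q s => -[XI [X1 [E regs]]].
have split_digit a : a = a %% Q + Q * (a %/ Q) by rewrite addnC mulnC -divn_eq.
have NI : N * (1 + Q * I) = N + Q * (N * I) by rewrite mulnDr muln1 mulnCA.
pose x e := X e %% Q; pose X' e := X e %/ Q.
have xI e : e < M -> x e <= 1 /\ bitle (X' e) I.
  move=> /XI; rewrite (split_digit (X e)) bitleQ ?ltn_mod //; last by lia.
  by move=> /andP[/bitle_leq].
have dotX c : dot M c X = dot M c x + Q * dot M c X'.
  by rewrite -dot_digits; apply: eq_dot.
(* Each lowest digit is at most 1 and there are [M < Q] of them, so their sum does not carry. *)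
have dot_x : dot M (fun=> 1) x < Q.
  apply: leq_ltn_trans ltM; rewrite /dot big_mkord -[X in _ <= X]card_ord -sum1_card.
  by apply: leq_sum => e _; rewrite mul1n; case: (xI e (ltn_ord e)).
have [/dot1_eq1[e0 lte0 xe0] dotX'] : dot M (fun=> 1) x = 1 /\ dot M (fun=> 1) X' = I.
  by apply: (@base_digit_inj Q); rewrite -?dotX //; lia.
have {}dotX c : dot M c X = c e0 + Q * dot M c X'.
  by rewrite dotX -(dot_pred1 c lte0) (eq_dot c xe0).
have [lts ltt] := lt_const _ lte0.
have [pcE ctrl] : pc = src e0 /\ dot M tgt X = dot M src X' + Q ^ s * h.
  by apply: (@base_digit_inj Q) => //; rewrite E dotX expnS; lia.
have zero_digits j e :
    R j + N * X e = (R j %% Q + N * x e) + Q * (R j %/ Q + N * X' e).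
  by rewrite {1}(split_digit (R j)) {1}(split_digit (X e)) -/(x e) -/(X' e); lia.
have reg j : j < J ->
    [/\ r j = R j %% Q /\ R' j = R j %/ Q + Q ^ s * F j,
        R' j %% Q + dec e0 j = R j %% Q + inc e0 j /\
        R' j %/ Q + dot M (dec^~ j) X' = R j %/ Q + dot M (inc^~ j) X',
        bitle (R j %/ Q) (N * I), bitle (R' j %/ Q) (N * I)
      & forall e, e < M -> zero e j ->
          R j %% Q + N * x e <= N /\ bitle (R j %/ Q + N * X' e) (N * I)].
  move=> /[dup] /lt_r ltj /regs [].
  rewrite NI {1}(split_digit (R j)) bitleQ ?ltn_mod //; last by lia.
  move=> /andP[/bitle_leq le_R bR] [].
  rewrite {1}(split_digit (R' j)) bitleQ ?ltn_mod //; last by lia.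
  move=> /andP[/bitle_leq le_R' bR'] [upd_j [link_j zero_j]]; split=> //.
  - apply: (@base_digit_inj Q); rewrite ?ltn_mod // link_j.
    by rewrite {1}(split_digit (R j)) expnS; lia.
  - apply: (@base_digit_inj Q); [by case: (dec e0 j); lia|by case: (inc e0 j); lia|].
    move: upd_j; rewrite !dotX {1}(split_digit (R j)) {1}(split_digit (R' j)); lia.
  - move=> e lte /(zero_j _ lte); have [le_x _] := xI _ lte.
    have le_Nx : N * x e <= N by nia.
    rewrite zero_digits // bitleQ; [|lia|lia].
    by move=> /andP[/bitle_leq].
exists e0; split=> //; exists (fun j => R' j %% Q).
  move=> j /reg [[-> _] [-> _] _ _ zero_j]; split=> // /(zero_j _ lte0) [].
  (* Since [e0] fires, the bound reads [R j %% Q + N <= N], so the tested counter is 0. *)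
  by rewrite xe0 // eqxx; lia.
apply: (IHs _ _ X' (fun j => R j %/ Q) (fun j => R' j %/ Q)) => //.
  by move=> j _; rewrite ltn_mod.
split; first by move=> e /xI[].
split=> //; split; first by rewrite -ctrl dotX.
move=> j /reg [[_ ER'] [_ ?] ? ? zero_j]; do !split=> //.
  by rewrite -split_digit.
by move=> e lte /(zero_j _ lte) [].
Qed.

(** Each step of the run prepends a digit to every number. A counter grows by at most 1 per step, so
    [r j + s < 2 ^ p] is preserved. *)
Lemma run_history p s pc r h :
  run s pc r h -> (forall j, j < J -> r j + s < 2 ^ p) ->
  exists X R R' F, history p s pc r h X R R' F.
Proof.
have := expn_gt0 2 p; rewrite /history.
set N := (2 ^ p).-1; rewrite orTb => p_gt0.
have Q_def : 2 ^ p.+1 = (N + N).+2 by rewrite expnS /N; lia.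
have bitleQ := @bitle_digits p.+1.
move: bitleQ; set Q := 2 ^ p.+1 in Q_def * => bitleQ.
elim: s pc r => [|s IHs] pc r /=.
  move=> -> lt_r; pose O (_ : nat) := 0.
  have dotO c : dot M c O = 0 by rewrite /dot big1 // => e _; rewrite muln0.
  exists O, O, O, r; rewrite !dotO muln0 addn0 mul1n; do !split=> //.
  - by rewrite muln0.
  - by rewrite muln0.
  - by rewrite (dotO (dec^~ j)) (dotO (inc^~ j)).
  - by move=> e _ _; rewrite /O !muln0.
move=> [e0 [lte0 -> [r' fire_e0 /IHs{}IHs]]] lt_r.
have [|X [R [R' [F [XI [X1 [ctrl regs]]]]]]] := IHs.
  by move=> j ltj; have := lt_r j ltj; have [] := fire_e0 j ltj; case: (inc e0 j); lia.
set I := repunit Q s in XI X1 ctrl regs *.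
have NI : N * (1 + Q * I) = N + Q * (N * I) by rewrite mulnDr muln1 mulnCA.
exists (fun e => (e == e0) + Q * X e), (fun j => r j + Q * R j),
  (fun j => r' j + Q * R' j), F.
have dotX c : dot M c (fun e => (e == e0) + Q * X e) = c e0 + Q * dot M c X.
  by rewrite dot_digits dot_pred1.
have leN a : a <= N -> bitle a N by move=> leaN; apply: bitle_full; lia.
split.
  move=> e lte; rewrite bitleQ ?XI ?andbT //; last by lia.
    by case: (e == e0).
  by case: (e == e0); lia.
rewrite !dotX; split; first by rewrite X1.
split; first by rewrite ctrl expnS; lia.
move=> j ltj; have [bR [bR' [upd_j [link_j zero_j]]]] := regs j ltj.
have := lt_r j ltj; have [fire_j zero_e0] := fire_e0 j ltj => lt_rj.
have lt_rj' : r' j <= N by move: fire_j; case: (inc e0 j); lia.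
rewrite !dotX NI; split; first by rewrite bitleQ ?bR ?andbT ?leN; lia.
split; first by rewrite bitleQ ?bR' ?andbT ?leN; lia.
split; first by lia.
split; first by rewrite link_j expnS; lia.
move=> e lte zej; have le_N : r j + N * (e == e0) <= N.
  by case: eqP zej => [-> /zero_e0 ->|_ _]; lia.
have -> : r j + Q * R j + N * ((e == e0) + Q * X e) =
          (r j + N * (e == e0)) + Q * (R j + N * X e) by lia.
by rewrite bitleQ ?zero_j ?leN //; lia.
Qed.

End Net.

(** * Register machines *)

Definition halts (P : seq instr) (x : nat) : Prop :=
  exists n, size P <= (iter n (step P) (init x)).1.

Lemma step_halted P c : size P <= c.1 -> step P c = c.
Proof. by case: c => pc R /= /onth_default ->. Qed.

Lemma step_nth P i0 pc R : pc < size P ->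
  step P (pc, R) =
    match nth i0 P pc with
    | Inc r => (pc.+1, upd R r (R r).+1)
    | Dec r l => if R r is n.+1 then (pc.+1, upd R r n) else (l, R)
    end.
Proof. by move=> ltpc; rewrite /= onthE (nth_map i0). Qed.

Section NetOfProgram.
Variable P : seq instr.

Let instr_at (e : nat) : instr := nth (Inc 0) P e./2.

Definition instr_reg (i : instr) : nat := match i with Inc r | Dec r _ => r end.

(* Transitions [2 i] and [2 i + 1] both come from line [i]; the latter is the
   jump of a [Dec], and a copy of the former for an [Inc]. *)
Definition net_tgt e :=
  if instr_at e is Dec _ l then if odd e then l else e./2.+1 else e./2.+1.
Definition net_inc e j := if instr_at e is Inc r then r == j else false.
Definition net_dec e j := if instr_at e is Dec r _ then ~~ odd e && (r == j) else false.
Definition net_zero e j := if instr_at e is Dec r _ then odd e && (r == j) else false.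
Definition net_size := (size P).*2.
(** The sum is a crude bound on every register number occurring in [P]. *)
Definition net_regs := (\sum_(i < size P) instr_reg (nth (Inc 0) P i)).+1.

Local Notation net_run := (run net_size net_regs half net_tgt net_inc net_dec net_zero).

Lemma instr_reg_lt e : e < net_size -> instr_reg (instr_at e) < net_regs.
Proof.
move=> lte; have lte2 : e./2 < size P by rewrite /net_size in lte; lia.
by rewrite ltnS (bigD1 (Ordinal lte2)) //= leq_addr.
Qed.

(** [fires] does not constrain registers from [net_regs] on, so the valuations are compared only
    below this bound; by [instr_reg_lt] the program touches no others. *)
Lemma net_run_machine s pc r R h :
  net_run s pc r h -> (forall j, j < net_regs -> R j = r j) ->
  exists n, (iter n (step P) (pc, R)).1 = h.
Proof.
elim: s pc r R => [|s IHs] pc r R /=; first by move=> -> _; exists 0.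
move=> [e [lte -> [r' fire_e run_s]]] eqR.
have lte2 : e./2 < size P by rewrite /net_size in lte; lia.
have [R' [stepE eqR']] : exists R', step P (e./2, R) = (net_tgt e, R') /\
    forall j, j < net_regs -> R' j = r' j.
  rewrite (step_nth (Inc 0)) // /net_tgt -/(instr_at e).
  have := instr_reg_lt lte; move: fire_e; rewrite /fires /net_inc /net_dec /net_zero.
  case: (instr_at e) => [q|q l] /= fire_e ltq.
    exists (upd R q (R q).+1); split=> // j ltj; have [+ _] := fire_e j ltj.
    by rewrite /upd eq_sym !eqR //; case: eqP => [->|_]; lia.
  have [] := fire_e q ltq; rewrite eqxx -eqR // andbT addn0.
  case: (odd e) fire_e => /= fire_e fire_q; rewrite ?andbT.
    move=> /(_ isT) ->; exists R; split=> // j ltj.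
    by have [+ _] := fire_e j ltj; rewrite !addn0 eqR.
  case ERq: (R q) fire_q => [|m]; first by lia.
  move=> fire_q _; exists (upd R q m); split=> // j ltj; have [+ _] := fire_e j ltj.
  rewrite /upd eq_sym -eqR //; case: eqP => [->|_]; rewrite ?ERq; lia.
have [n nE] := IHs _ _ _ run_s eqR'.
by exists n.+1; rewrite iterSr stepE.
Qed.

Lemma machine_net_run n pc R :
  size P <= (iter n (step P) (pc, R)).1 ->
  exists s h, size P <= h /\ net_run s pc R h.
Proof.
elim: n pc R => [|n IHn] pc R; first by exists 0, pc.
case: (leqP (size P) pc) => [lepc _|ltpc]; first by exists 0, pc.
rewrite iterSr.
have [e [lte pcE [R' fire_e stepE]]] : exists e, [/\ e < net_size, pc = e./2 &
    exists2 R', fires net_regs net_inc net_dec net_zero e R R' &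
                step P (pc, R) = (net_tgt e, R')].
  rewrite (step_nth (Inc 0)) //.
  (* The odd transition is the jump of a [Dec], taken when its register is 0. *)
  pose b := if nth (Inc 0) P pc is Dec q _ then R q == 0 else false.
  exists (pc.*2 + b).
  have half_e : (pc.*2 + b)./2 = pc by rewrite addnC half_bit_double.
  have odd_e : odd (pc.*2 + b) = b by rewrite oddD odd_double oddb.
  split=> //; first by rewrite /net_size; case: (b); lia.
  rewrite /net_tgt /fires /net_inc /net_dec /net_zero /instr_at half_e odd_e.
  rewrite {half_e odd_e}/b.
  case: (nth _ P pc) => [q|q l].
    exists (upd R q (R q).+1) => // j _; rewrite /upd eq_sym; split=> //.
    by case: eqP => [->|_]; lia.
  case ERq: (R q) => [|m] /=.
    by exists R => // j _; split=> // /eqP <-.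
  exists (upd R q m) => // j _; rewrite /upd eq_sym; split=> //.
  by case: eqP => [<-|_]; rewrite ?ERq; lia.
rewrite stepE => /IHn[s [h [leh run_s]]]; exists s.+1, h; split=> //.
by exists e; split=> //; exists R'.
Qed.

(** Bounds the number of transitions and all control states at once, as [history_run] requires. *)
Definition net_bound := net_size + \sum_(e < net_size) (e./2 + net_tgt e).

Lemma halts_history x :
  halts P x <->
  exists p s h, net_bound + x < 2 ^ p /\ size P <= h /\
    exists X R R' F,
      history net_size net_regs half net_tgt net_inc net_dec net_zero
        p s 0 (init x).2 h X R R' F.
Proof.
split=> [[n /machine_net_run[s [h [leh run_s]]]]|].
  (* Since [n < 2 ^ n], the sum of all required bounds can itself serve as [p]. *)
  have ltp := ltn_expl (net_bound + x + s) (ltnSn 1).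
  exists (net_bound + x + s), s, h; split; first by lia.
  split=> //; apply: (run_history run_s) => j _ /=; apply: leq_ltn_trans ltp.
  by case: eqP; lia.
move=> [p [s [h [ltp [leh [X [R [R' [F]]]]]]]]].
have ltQ : 2 ^ p < 2 ^ p.+1 by rewrite ltn_exp2l.
move=> /history_run/net_run_machine hist.
have [||||//|n nE] := hist (init x).2.
- move=> e lte; have : e./2 + net_tgt e <= net_bound.
    by rewrite /net_bound (bigD1 (Ordinal lte)) //=; lia.
  by lia.
- by rewrite /net_bound in ltp; lia.
- by lia.
- by move=> j _ /=; case: eqP; lia.
- by exists n; rewrite nE.
Qed.

End NetOfProgram.

(** * The diagonal machine *)

(* As jumps are absolute, a block depends on the address of its first line. *)
Definition block := nat -> seq instr.

(** Quantifying over the surrounding program makes blocks composable. *)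
Definition exec (b : block) (R R' : nat -> nat) : Prop :=
  forall pre post, exists n,
    iter n (step (pre ++ b (size pre) ++ post)) (size pre, R) =
      (size pre + size (b (size pre)), R').

Definition binc (r : nat) : block := fun=> [:: Inc r].

Definition bskip : block := fun=> [::].

Definition bseq (b c : block) : block := fun k => b k ++ c (k + size (b k)).

(* The backward jump tests register 4, which blocks leave at 0. *)
Definition bloop (r : nat) (b : block) : block := fun k =>
  Dec r (k + size (b k.+1)).+2 :: b k.+1 ++ [:: Dec 4 k].

Lemma step_cat s1 i s2 R :
  step (s1 ++ i :: s2) (size s1, R) =
    match i with
    | Inc r => ((size s1).+1, upd R r (R r).+1)
    | Dec r l => if R r is n.+1 then ((size s1).+1, upd R r n) else (l, R)
    end.
Proof. by rewrite /step onth_cat ltnn subnn. Qed.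

Lemma exec_binc r R : exec (binc r) R (upd R r (R r).+1).
Proof.
move=> pre post; exists 1.
by rewrite /iter step_cat addn1.
Qed.

Lemma exec_bskip R : exec bskip R R.
Proof. by move=> pre post; exists 0; rewrite addn0. Qed.

Lemma exec_bseq b c R R1 R2 : exec b R R1 -> exec c R1 R2 -> exec (bseq b c) R R2.
Proof.
move=> bP cP pre post; rewrite /bseq; set k := size pre; set k' := k + size (b k).
have sz : size (pre ++ b k) = k' by rewrite size_cat.
have [n nE] := bP pre (c k' ++ post); have [m mE] := cP (pre ++ b k) post.
exists (m + n); rewrite -catA iterD nE -/k -/k' size_cat addnA -/k'.
by rewrite sz -catA in mE; rewrite mE.
Qed.

Lemma exec_bloop0 r b R : R r = 0 -> exec (bloop r b) R R.
Proof.
move=> R0 pre post; exists 1; rewrite /iter cat_cons step_cat R0.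
by rewrite /= size_cat /= addn1 !addnS.
Qed.

Lemma exec_bloopS r b R R1 R2 n : R r = n.+1 -> exec b (upd R r n) R1 -> R1 4 = 0 ->
  exec (bloop r b) R1 R2 -> exec (bloop r b) R R2.
Proof.
move=> Rr bP R4 loopP pre post; set k := size pre.
pose enter := Dec r (k + size (b k.+1)).+2.
have sz : size (pre ++ [:: enter]) = k.+1 by rewrite size_cat addn1.
have [m mE] := bP (pre ++ [:: enter]) ([:: Dec 4 k] ++ post).
have [m' m'E] := loopP pre post; exists (m' + (1 + (m + 1))).
rewrite iterD [iter (1 + _) _ _]iterD [iter (m + 1) _ _]iterD.
set P := pre ++ _ ++ post.
have PE : P = (pre ++ [:: enter]) ++ b k.+1 ++ [:: Dec 4 k] ++ post.
  by rewrite /P /bloop -/enter -!catA /= -catA.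
have -> : iter 1 (step P) (k, R) = (k.+1, upd R r n).
  by rewrite /iter step_cat Rr.
rewrite sz -PE in mE; rewrite mE.
have -> : iter 1 (step P) (k.+1 + size (b k.+1), R1) = (k, R1).
  have -> : k.+1 + size (b k.+1) = size ((pre ++ [:: enter]) ++ b k.+1).
    by rewrite size_cat sz.
  by rewrite PE catA /iter step_cat R4.
exact: m'E.
Qed.

(** [S i] is the state at the head of the loop when [i] rounds remain. *)
Lemma exec_bloop r b (S : nat -> nat -> nat) n :
  (forall i, S i r = i) -> (forall i, S i 4 = 0) ->
  (forall i, i < n -> exec b (upd (S i.+1) r i) (S i)) -> exec (bloop r b) (S n) (S 0).
Proof.
move=> Sr S4; elim: n => [|n IHn] bP; first exact: exec_bloop0.
apply: exec_bloopS; [exact: Sr|exact: bP|exact: S4|].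
by apply: IHn => i ltin; apply: bP; apply: ltnW.
Qed.

(** Register 0 keeps the input, 1 the number to be pushed, 2 the code of the list under
    construction, and 3 is scratch. All others, register 4 included, are 0. *)
Definition regs4 (n a m t : nat) : nat -> nat := nth 0 [:: n; a; m; t].

Lemma upd_regs4 n a m t x :
  (upd (regs4 n a m t) 0 x = regs4 x a m t) * (upd (regs4 n a m t) 1 x = regs4 n x m t) *
  (upd (regs4 n a m t) 2 x = regs4 n a x t) * (upd (regs4 n a m t) 3 x = regs4 n a m x).
Proof. by do !split; apply: functional_extensionality => -[|[|[|[|i]]]]. Qed.

Lemma exec_binc0 n a m t : exec (binc 0) (regs4 n a m t) (regs4 n.+1 a m t).
Proof. by have := exec_binc 0 (regs4 n a m t); rewrite upd_regs4. Qed.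

Lemma exec_binc1 n a m t : exec (binc 1) (regs4 n a m t) (regs4 n a.+1 m t).
Proof. by have := exec_binc 1 (regs4 n a m t); rewrite upd_regs4. Qed.

Lemma exec_binc2 n a m t : exec (binc 2) (regs4 n a m t) (regs4 n a m.+1 t).
Proof. by have := exec_binc 2 (regs4 n a m t); rewrite upd_regs4. Qed.

Lemma exec_binc3 n a m t : exec (binc 3) (regs4 n a m t) (regs4 n a m t.+1).
Proof. by have := exec_binc 3 (regs4 n a m t); rewrite upd_regs4. Qed.

Definition bdouble : block :=
  bseq (bloop 2 (bseq (binc 3) (binc 3))) (bloop 3 (binc 2)).

Lemma exec_bdouble n a m : exec bdouble (regs4 n a m 0) (regs4 n a m.*2 0).
Proof.
apply: (@exec_bseq _ _ _ (regs4 n a 0 m.*2)).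
  have := @exec_bloop 2 (bseq (binc 3) (binc 3)) (fun i => regs4 n a i (m - i).*2) m.
  rewrite subnn subn0; apply=> // i ltim; rewrite upd_regs4.
  have -> : (m - i).*2 = (m - i.+1).*2.+2 by lia.
  by apply: exec_bseq; apply: exec_binc3.
have := @exec_bloop 3 (binc 2) (fun i => regs4 n a (m.*2 - i) i) m.*2.
rewrite subnn subn0; apply=> // i ltim; rewrite upd_regs4.
have -> : m.*2 - i = (m.*2 - i.+1).+1 by lia.
exact: exec_binc2.
Qed.

(* [CodeSeq.code (a :: s)] is [2 ^ a * (CodeSeq.code s).*2.+1]. *)
Definition bpush : block := bseq bdouble (bseq (binc 2) (bloop 1 bdouble)).

Lemma exec_bpush n a s :
  exec bpush (regs4 n a (CodeSeq.code s) 0) (regs4 n 0 (CodeSeq.code (a :: s)) 0).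
Proof.
apply: exec_bseq; first exact: exec_bdouble.
apply: exec_bseq; first exact: exec_binc2.
set m := _.*2.+1.
have := @exec_bloop 1 bdouble (fun i => regs4 n i (2 ^ (a - i) * m) 0) a.
rewrite subnn subn0 mul1n; apply=> // i ltia; rewrite upd_regs4.
have -> : 2 ^ (a - i) * m = (2 ^ (a - i.+1) * m).*2.
  by rewrite (_ : a - i = (a - i.+1).+1) ?expnS -?mulnA ?mul2n //; lia.
exact: exec_bdouble.
Qed.

Definition bcopy : block :=
  bseq (bloop 0 (bseq (binc 1) (binc 3))) (bloop 3 (binc 0)).

Lemma exec_bcopy n m : exec bcopy (regs4 n 0 m 0) (regs4 n n m 0).
Proof.
apply: (@exec_bseq _ _ _ (regs4 0 n m n)).
  have := @exec_bloop 0 (bseq (binc 1) (binc 3)) (fun i => regs4 i (n - i) m (n - i)) n.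
  rewrite subnn subn0; apply=> // i ltin; rewrite upd_regs4.
  have -> : n - i = (n - i.+1).+1 by lia.
  by apply: exec_bseq; [apply: exec_binc1|apply: exec_binc3].
have := @exec_bloop 3 (binc 0) (fun i => regs4 (n - i) n m i) n.
rewrite subnn subn0; apply=> // i ltin; rewrite upd_regs4.
have -> : n - i = (n - i.+1).+1 by lia.
exact: exec_binc0.
Qed.

Definition bset (k : nat) : block := iter k (bseq (binc 1)) bskip.

Lemma exec_bset k n m : exec (bset k) (regs4 n 0 m 0) (regs4 n k m 0).
Proof.
suff main a : exec (bset k) (regs4 n a m 0) (regs4 n (k + a) m 0).
  by rewrite -{2}(addn0 k).
elim: k a => [|k IHk] a; first exact: exec_bskip.
by apply: exec_bseq; [apply: exec_binc1|rewrite addSnnS; apply: IHk].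
Qed.

Definition bmove : block := bloop 2 (binc 1).

Lemma exec_bmove n m : exec bmove (regs4 n 0 m 0) (regs4 n m 0 0).
Proof.
have := @exec_bloop 2 (binc 1) (fun i => regs4 n (m - i) i 0) m.
rewrite subnn subn0; apply=> // i ltim; rewrite upd_regs4.
have -> : m - i = (m - i.+1).+1 by lia.
exact: exec_binc1.
Qed.

Definition breturn : block := bseq (bloop 0 bskip) (bloop 2 (binc 0)).

Lemma exec_breturn n m : exec breturn (regs4 n 0 m 0) (regs4 m 0 0 0).
Proof.
apply: (@exec_bseq _ _ _ (regs4 0 0 m 0)).
  apply: (@exec_bloop 0 bskip (fun i => regs4 i 0 m 0)) => // i _.
  by rewrite upd_regs4; apply: exec_bskip.
have := @exec_bloop 2 (binc 0) (fun i => regs4 (m - i) 0 i 0) m.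
rewrite subnn subn0; apply=> // i ltim; rewrite upd_regs4.
have -> : m - i = (m - i.+1).+1 by lia.
exact: exec_binc0.
Qed.

Definition bpush_const (k : nat) : block := bseq (bset k) bpush.
Definition bpush_input : block := bseq bcopy bpush.
(** A finished list becomes, through its code, the only entry of a new list. This is how subterms
    enter the code of a term. *)
Definition bwrap : block := bseq bmove bpush.

Lemma exec_bpush_const k n s :
  exec (bpush_const k) (regs4 n 0 (CodeSeq.code s) 0)
    (regs4 n 0 (CodeSeq.code (k :: s)) 0).
Proof. by apply: exec_bseq; [apply: exec_bset|apply: exec_bpush]. Qed.

Lemma exec_bpush_input n s :
  exec bpush_input (regs4 n 0 (CodeSeq.code s) 0) (regs4 n 0 (CodeSeq.code (n :: s)) 0).
Proof. by apply: exec_bseq; [apply: exec_bcopy|apply: exec_bpush]. Qed.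

Lemma exec_bwrap n s :
  exec bwrap (regs4 n 0 (CodeSeq.code s) 0)
    (regs4 n 0 (CodeSeq.code [:: CodeSeq.code s]) 0).
Proof. by apply: exec_bseq; [apply: exec_bmove|apply: (@exec_bpush _ _ [::])]. Qed.

(** [NVar 0] is the first parameter in the convention of [definable] below. *)
Definition instantiate (Sigma : finType) (p : qform Sigma) (n : nat) : eform Sigma :=
  Matrix (And p (NatEq (NVar 0) (NConst n))).

(** The code is built from its innermost, last entry outwards. The input is pushed twice, first as
    the numeral and then as the code of [p]: this is the self-reference of the diagonal argument. *)
Definition binstantiate : block :=
  bseq bpush_input (bseq (bpush_const 1)
  (bseq bwrap (bseq (bpush_const (CodeSeq.code [:: 0; 0])) (bseq (bpush_const 1)
  (bseq bwrap (bseq bpush_input (bseq (bpush_const 5)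
  (bseq bwrap (bseq (bpush_const 0) breturn))))))))).

Lemma exec_binstantiate (Sigma : finType) (p : qform Sigma) :
  exec binstantiate (regs4 (code_qform p) 0 0 0)
    (regs4 (code_eform (instantiate p (code_qform p))) 0 0 0).
Proof.
(* Register 2 starts at 0, the code of the empty list. *)
rewrite -[X in regs4 _ 0 X 0]/(CodeSeq.code [::]).
rewrite /binstantiate; set k0 := CodeSeq.code [:: 0; 0].
apply: exec_bseq; first exact: exec_bpush_input.
apply: exec_bseq; first exact: exec_bpush_const.
apply: exec_bseq; first exact: exec_bwrap.
apply: exec_bseq; first exact: exec_bpush_const.
apply: exec_bseq; first exact: exec_bpush_const.
apply: exec_bseq; first exact: exec_bwrap.
apply: exec_bseq; first exact: exec_bpush_input.
apply: exec_bseq; first exact: exec_bpush_const.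
apply: exec_bseq; first exact: exec_bwrap.
apply: exec_bseq; first exact: exec_bpush_const.
exact: exec_breturn.
Qed.

Lemma init_regs4 n : (init n).2 = regs4 n 0 0 0.
Proof.
by apply: functional_extensionality => -[|[|[|[|i]]]]; rewrite //= /regs4 /= nth_nil.
Qed.

(** * Running a decision procedure and inverting its answer *)

Section Diagonal.
Variables B P : seq instr.

Let start := size B.
Let stop := start + size P.

(** Jumps out of [P] are redirected to the line just after its copy, so that every way of halting
    leads to [stop]. *)
Definition relocate (i : instr) : instr :=
  match i with Inc r => Inc r | Dec r l => Dec r (start + minn l (size P)) end.

(* Applied to the value 0 or 1 left by [P], the last two lines halt or loop. *)
Definition diagonal : seq instr :=
  B ++ map relocate P ++ [:: Dec 0 stop.+2; Dec 0 stop.+1].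

Lemma size_diagonal : size diagonal = stop.+2.
Proof. by rewrite !size_cat size_map addnA addn2. Qed.

Let embed (c : config) : config := (start + minn c.1 (size P), c.2).

(** The step counts may differ, since a halted [P] stays where it is while [diagonal] would go
    on. *)
Lemma diagonal_simulates n c :
  exists m, iter m (step diagonal) (embed c) = embed (iter n (step P) c).
Proof.
elim: n c => [|n IHn] c; first by exists 0.
rewrite iterSr; case: (leqP (size P) c.1) => [halted|ltpc].
  by rewrite (step_halted halted).
have [m mE] := IHn (step P c); exists m.+1; rewrite iterSr -mE; congr (iter _ _ _).
case: c ltpc {mE} => pc R; rewrite [(pc, R).1]/= => ltpc.
rewrite (_ : embed (pc, R) = (start + pc, R)); last first.
  by rewrite /embed (minn_idPl (ltnW ltpc)).
rewrite (step_nth (Inc 0)) ?size_diagonal; last by rewrite /stop; lia.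
rewrite /diagonal nth_cat ltnNge leq_addr /= addKn nth_cat size_map ltpc.
rewrite (nth_map (Inc 0)) //= onthE (nth_map (Inc 0)) //=.
case: (nth _ P pc) => [r|r l] /=; first by rewrite /embed /= (minn_idPl ltpc) addnS.
by case: (R r) => //= q; rewrite /embed /= (minn_idPl ltpc) addnS.
Qed.

Lemma diagonal_reaches x0 x y :
  (exists m, iter m (step diagonal) (init x0) = (start, (init x).2)) ->
  computes P x y ->
  exists m R, iter m (step diagonal) (init x0) = (stop, R) /\ R 0 = y.
Proof.
move=> [m mE] [n [haltP yE]]; have [m' m'E] := diagonal_simulates n (init x).
exists (m' + m), (iter n (step P) (init x)).2; split=> //.
by rewrite iterD mE -[start]addn0 -(min0n (size P)) m'E /embed (minn_idPr haltP).
Qed.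

Lemma halts_at_stop x m R :
  iter m (step diagonal) (init x) = (stop, R) -> R 0 = 0 -> halts diagonal x.
Proof.
move=> mE R0; exists m.+1; rewrite iterS mE (step_nth (Inc 0)) ?size_diagonal //.
by rewrite /diagonal catA nth_cat size_cat size_map -/start -/stop ltnn subnn /= R0.
Qed.

Lemma loops_at_stop x m R :
  iter m (step diagonal) (init x) = (stop, R) -> R 0 = 1 -> ~ halts diagonal x.
Proof.
move=> mE R0 [n haltn].
have step_loop R' : R' 0 = 0 -> step diagonal (stop.+1, R') = (stop.+1, R').
  move=> R'0; rewrite (step_nth (Inc 0)) ?size_diagonal //.
  rewrite /diagonal catA nth_cat size_cat size_map -/start -/stop ltnNge leqnSn.
  by rewrite subSnn /= R'0.
have mE1 : iter m.+1 (step diagonal) (init x) = (stop.+1, upd R 0 0).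
  rewrite iterS mE (step_nth (Inc 0)) ?size_diagonal //.
  by rewrite /diagonal catA nth_cat size_cat size_map -/start -/stop ltnn subnn /= R0.
(* Running [n] and [m.+1] steps in either order gives the same configuration, so the halted one
   would be the looping one, whose program counter is inside the program. *)
have := iter_fix m.+1 (step_halted haltn); rewrite -iterD addnC iterD mE1.
rewrite iter_fix; last exact: step_loop.
by move=> E; move: haltn; rewrite -E size_diagonal ltnn.
Qed.

End Diagonal.

Lemma diagonal_computes (Sigma : finType) P (p : qform Sigma) y :
  let B := binstantiate 0 in let n := code_qform p in
  computes P (code_eform (instantiate p n)) y ->
  exists m R, iter m (step (diagonal B P)) (init n) = (size B + size P, R) /\ R 0 = y.
Proof.
move=> B n; apply: diagonal_reaches.
have [m] := exec_binstantiate p [::]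
  (map (relocate B P) P ++ [:: Dec 0 (size B + size P).+2; Dec 0 (size B + size P).+1]).
by rewrite -!init_regs4 => mE; exists m.
Qed.

(** * Interleaving of assignments *)

Definition odouble (i : nat) : nat := i.*2.+1.

Definition join (T : Type) (f g : nat -> T) (i : nat) : T :=
  if odd i then g i./2 else f i./2.

Lemma join_double (T : Type) (f g : nat -> T) : join f g \o double = f.
Proof.
by apply: functional_extensionality => i; rewrite /join /= odd_double doubleK.
Qed.

Lemma join_odouble (T : Type) (f g : nat -> T) : join f g \o odouble = g.
Proof.
apply: functional_extensionality => i.
by rewrite /join /= odd_double /= uphalf_double.
Qed.

Lemma comp_join (T U : Type) (h : T -> U) (f g : nat -> T) :
  h \o join f g = join (h \o f) (h \o g).
Proof. by apply: functional_extensionality => i; rewrite /join /=; case: odd. Qed.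

(** * Relations definable by existential formulas *)

Section Definability.
Variables (Sigma : finType) (c0 c1 : Sigma).

Fixpoint sren (f : nat -> nat) (s : sterm Sigma) : sterm Sigma :=
  match s with
  | SVar i => SVar (f i)
  | SConst w => SConst w
  | SCat s t => SCat (sren f s) (sren f t)
  end.

Fixpoint nren (f g : nat -> nat) (u : nterm Sigma) : nterm Sigma :=
  match u with
  | NVar i => NVar (g i)
  | NConst n => NConst n
  | NLen s => NLen (sren f s)
  | NAdd u v => NAdd (nren f g u) (nren f g v)
  | NScale k u => NScale k (nren f g u)
  end.

Fixpoint qren (f g : nat -> nat) (p : qform Sigma) : qform Sigma :=
  match p with
  | WordEq s t => WordEq (sren f s) (sren f t)
  | NatEq u v => NatEq (nren f g u) (nren f g v)
  | NatLe u v => NatLe (nren f g u) (nren f g v)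
  | StrNum s u => StrNum (sren f s) (nren f g u)
  | Not p => Not (qren f g p)
  | And p q => And (qren f g p) (qren f g q)
  | Or p q => Or (qren f g p) (qren f g q)
  end.

Lemma seval_ren f sv s : seval sv (sren f s) = seval (sv \o f) s.
Proof. by elim: s => //= s -> t ->. Qed.

Lemma neval_ren f g sv nv u :
  neval sv nv (nren f g u) = neval (sv \o f) (nv \o g) u.
Proof.
elim: u => //= [s|u -> v ->|k u ->] //.
by rewrite seval_ren.
Qed.

Lemma qholds_ren f g sv nv p :
  qholds c0 c1 sv nv (qren f g p) = qholds c0 c1 (sv \o f) (nv \o g) p.
Proof.
by elim: p => //= *; rewrite ?seval_ren ?neval_ren //; congruence.
Qed.

(* The variables of even index are the parameters, all other variables are
   existentially quantified; closure under conjunction and quantification is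
   then mere renaming. *)
Definition definable (R : (nat -> nat) -> Prop) : Prop :=
  exists p : qform Sigma, forall v,
    R v <-> exists sv w, qholds c0 c1 sv (join v w) p.

Lemma definable_ext (R R' : (nat -> nat) -> Prop) :
  (forall v, R' v <-> R v) -> definable R -> definable R'.
Proof. by move=> RR' [p Rp]; exists p => v; rewrite RR'. Qed.

Lemma definable_matrix p (R : (nat -> nat) -> Prop) :
  (forall v w sv, R v <-> qholds c0 c1 sv (join v w) p) -> definable R.
Proof.
move=> Rp; exists p => v; split=> [/Rp Rv|[sv [w /Rp //]]].
by exists (fun=> [::]), (fun=> 0); apply: Rv.
Qed.

Lemma definable_ren (g : nat -> nat) R :
  definable R -> definable (fun v => R (v \o g)).
Proof.
move=> [p Rp]; exists (qren id (join (double \o g) odouble) p) => v.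
have vg w : join v w \o join (double \o g) odouble = join (v \o g) w.
  by rewrite comp_join compA join_double join_odouble.
rewrite Rp; split=> -[sv [w pw]]; exists sv, w; move: pw;
  by rewrite qholds_ren vg.
Qed.

(** The parameters are shared, while the auxiliary variables of the two formulas, strings and
    numbers alike, are interleaved to become disjoint. *)
Lemma definable_and R R' :
  definable R -> definable R' -> definable (fun v => R v /\ R' v).
Proof.
move=> [p Rp] [q Rq].
exists (And (qren double (join double (odouble \o double)) p)
            (qren odouble (join double (odouble \o odouble)) q)) => v.
have vl w : join v w \o join double (odouble \o double) = join v (w \o double).
  by rewrite comp_join join_double compA join_odouble.
have vr w : join v w \o join double (odouble \o odouble) = join v (w \o odouble).
  by rewrite comp_join join_double compA join_odouble.
rewrite Rp Rq; split=> /=.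
- move=> [[sv [w pw]] [sv' [w' qw']]]; exists (join sv sv'), (join w w').
  by rewrite !qholds_ren vl vr !join_double !join_odouble.
- move=> [sv [w]]; rewrite !qholds_ren vl vr => -[pw qw].
  by split; [exists (sv \o double), (w \o double)
            |exists (sv \o odouble), (w \o odouble)].
Qed.

(** The values of [f], at the even parameters, are turned into auxiliary variables. A formula
    mentions only finitely many of them, so quantifying over a function stays first-order. *)
Lemma definable_exf (R : (nat -> nat) -> (nat -> nat) -> Prop) :
  definable (fun v => R (v \o double) (v \o odouble)) ->
  definable (fun v => exists f, R f v).
Proof.
move=> [p Rp].
pose g := join (join (odouble \o double) double) (odouble \o odouble).
have vg v w : join v w \o g = join (join (w \o double) v) (w \o odouble).
  by rewrite /g comp_join comp_join join_double 2!compA join_odouble.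
exists (qren id g p) => v; split.
- move=> [f Rfv]; have := Rp (join f v).
  rewrite join_double join_odouble => -[/(_ Rfv)[sv [w pw]] _].
  by exists sv, (join f w); rewrite qholds_ren vg join_double join_odouble.
- move=> [sv [w]]; rewrite qholds_ren vg => pw; exists (w \o double).
  have := Rp (join (w \o double) v).
  by rewrite join_double join_odouble => -> ; exists sv, (w \o odouble).
Qed.

(** Parameters act as de Bruijn indices, the bound value being parameter 0. *)
Lemma definable_ex (R : nat -> (nat -> nat) -> Prop) :
  definable (fun v => R (v 0) (v \o succn)) ->
  definable (fun v => exists x, R x v).
Proof.
move=> defR; apply: (@definable_ext (fun v => exists f : nat -> nat, R (f 0) v)).
  by move=> v; split=> [[x]|[f]]; [exists (fun=> x)|exists (f 0)].
apply: definable_exf.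
exact: (definable_ren (fun i => if i is j.+1 then odouble j else 0) defR).
Qed.

Definition definable_fun (t : (nat -> nat) -> nat) : Prop :=
  definable (fun v => v 0 = t (v \o succn)).

Lemma definable_fun_ren (g : nat -> nat) t :
  definable_fun t -> definable_fun (fun v => t (v \o g)).
Proof.
exact: (definable_ren (fun i => if i is j.+1 then (g j).+1 else 0)).
Qed.

Lemma definable_subst (R : nat -> (nat -> nat) -> Prop) t :
  definable_fun t -> definable (fun v => R (v 0) (v \o succn)) ->
  definable (fun v => R (t v) v).
Proof.
move=> deft defR.
apply: (@definable_ext (fun v => exists x, x = t v /\ R x v)).
  by move=> v; split=> [Rv|[x [-> //]]]; exists (t v).
by apply: definable_ex; apply: definable_and.
Qed.

Lemma definable_app2 (R : nat -> nat -> Prop) t u :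
  definable (fun v => R (v 0) (v 1)) -> definable_fun t -> definable_fun u ->
  definable (fun v => R (t v) (u v)).
Proof.
move=> defR deft defu.
apply: (definable_subst (R := fun x v => R x (u v)) deft).
apply: (definable_subst (R := fun y v => R (v 0) y) (t := fun v => u (v \o succn))).
  exact: definable_fun_ren.
(* [1 - i] exchanges parameters 0 and 1: the value of [u], substituted last, is parameter 0. *)
exact: (definable_ren (fun i => 1 - i) defR).
Qed.

Lemma definable_fun_app2 (h : nat -> nat -> nat) t u :
  definable (fun v => v 2 = h (v 0) (v 1)) ->
  definable_fun t -> definable_fun u ->
  definable_fun (fun v => h (t v) (u v)).
Proof.
move=> defh deft defu; rewrite /definable_fun.
apply: (definable_subst (R := fun x v => v 0 = h x (u (v \o succn)))
          (t := fun v => t (v \o succn))).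
  exact: definable_fun_ren.
apply: (definable_subst (R := fun y v => v 1 = h (v 0) y)
          (t := fun v => u (v \o succn \o succn))).
  exact: (definable_fun_ren (fun i => i.+2)).
exact: (definable_ren (fun i => nth 0 [:: 1; 0; 2] i) defh).
Qed.

Lemma definable_var i : definable_fun (fun v => v i).
Proof.
apply: (@definable_matrix (NatEq (NVar 0) (NVar i.+1.*2))) => v w sv /=.
by rewrite /join /= odd_double doubleK.
Qed.

Lemma definable_const n : definable_fun (fun=> n).
Proof. exact: (@definable_matrix (NatEq (NVar 0) (NConst n))). Qed.

Lemma definable_add t u :
  definable_fun t -> definable_fun u -> definable_fun (fun v => t v + u v).
Proof.
apply: definable_fun_app2.
exact: (@definable_matrix (NatEq (NVar 4) (NAdd (NVar 0) (NVar 2)))).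
Qed.

Lemma definable_scale k t :
  definable_fun t -> definable_fun (fun v => k * t v).
Proof.
move=> deft; apply: (definable_subst (R := fun x v => v 0 = k * x)
  (t := fun v => t (v \o succn))); first exact: definable_fun_ren.
exact: (@definable_matrix (NatEq (NVar 2) (NScale k (NVar 0)))).
Qed.

Lemma definable_eq t u :
  definable_fun t -> definable_fun u -> definable (fun v => t v = u v).
Proof.
apply: (definable_app2 (R := fun x y => x = y)).
exact: (@definable_matrix (NatEq (NVar 0) (NVar 2))).
Qed.

Lemma definable_le t u :
  definable_fun t -> definable_fun u -> definable (fun v => t v <= u v).
Proof.
apply: (definable_app2 (R := fun x y => x <= y)).
exact: (@definable_matrix (NatLe (NVar 0) (NVar 2))).
Qed.

Lemma definable_succ t :
  definable_fun t -> definable_fun (fun v => (t v).+1).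
Proof.
move=> deft; apply: definable_ext (definable_add (definable_const 1) deft).
by move=> v; rewrite add1n.
Qed.

Lemma definable_dot n c (X : nat -> (nat -> nat) -> nat) :
  (forall e, definable_fun (X e)) -> definable_fun (fun v => dot n c (X^~ v)).
Proof.
move=> defX; elim: n => [|n IHn].
  by apply: definable_ext (definable_const 0) => v; rewrite /dot big_geq.
apply: definable_ext (definable_add IHn (definable_scale (c n) (defX n))) => v.
by rewrite /dot big_nat_recr.
Qed.

Lemma definable_all n (R : nat -> (nat -> nat) -> Prop) :
  (forall i, definable (R i)) -> definable (fun v => forall i, i < n -> R i v).
Proof.
move=> defR; elim: n => [|n IHn].
  by apply: definable_ext (definable_eq (definable_const 0) (definable_const 0)).
apply: definable_ext (definable_and IHn (defR n)) => v; split=> [Rv|[Rv Rn] i].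
  by split=> [i ltin|]; apply: Rv => //; apply: ltnW.
by rewrite ltnS leq_eqVlt => /predU1P[->|/Rv].
Qed.

Lemma definable_imply (b : bool) R : definable R -> definable (fun v => b -> R v).
Proof.
move=> defR; case: b; first by apply: definable_ext defR => v; split=> // /(_ isT).
by apply: definable_ext (definable_eq (definable_const 0) (definable_const 0)).
Qed.

(** * Defining arithmetic by means of strings *)

Hypothesis c0_neq_c1 : c0 <> c1.

Let digit (d : bool) : Sigma := if d then c1 else c0.

Lemma digit_inj : injective digit.
Proof. by case=> -[] //= /esym. Qed.

(** [t] is a block of [y] zeros. The shifted number is a successor because zeros appended to the
    numeral of 0 would not give a canonical numeral. *)
Lemma shift_strnum x y z :
  z = x.+1 * 2 ^ y <->
  exists s t : seq Sigma,
    [/\ strnum c0 c1 s x.+1, strnum c0 c1 (s ++ t) z, t ++ [:: c0] = c0 :: t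
      & size t = y].
Proof.
split=> [->|[_ [t [[b [_ -> bx]] [b' [_ Eb' <-]] Et ty]]]].
- have [b hb bx] := binval_surj x.
  exists (map digit b), (nseq y c0); split; last by rewrite size_nseq.
  + by exists b; rewrite /canonical hb orbT.
  + exists (b ++ nseq y false); split; last by rewrite binval_cat_zeros bx.
      by case: b hb bx => //= d b ->; rewrite /canonical orbT.
    by rewrite map_cat map_nseq.
  + by elim: y => //= y ->.
- move: Eb'; rewrite (commute_letter_nseq Et) ty.
  rewrite (_ : nseq y c0 = map digit (nseq y false)) -?map_cat ?map_nseq //.
  by move/(inj_map digit_inj) => <-; rewrite binval_cat_zeros bx.
Qed.

Lemma definable_mulpow2 t u :
  definable_fun t -> definable_fun u -> definable_fun (fun v => t v * 2 ^ u v).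
Proof.
have shift_succ t' u' : definable_fun t' -> definable_fun u' ->
    definable_fun (fun v => (t' v).+1 * 2 ^ u' v).
  apply: (definable_fun_app2 (h := fun x y => x.+1 * 2 ^ y)).
  (* The parameters 0, 1 and 2 are the number variables 0, 2 and 4; the string variables 0 and 1 are
     the strings of [shift_strnum]. *)
  exists (And (StrNum (SVar 0) (NAdd (NConst 1) (NVar 0)))
         (And (StrNum (SCat (SVar 0) (SVar 1)) (NVar 4))
         (And (WordEq (SCat (SVar 1) (SConst [:: c0]))
                      (SCat (SConst [:: c0]) (SVar 1)))
              (NatEq (NLen (SVar 1)) (NVar 2))))) => v.
  rewrite shift_strnum; split.
    move=> [s [t'' [ss st tt ty]]].
    by exists (fun i => if i is 0 then s else t''), (fun=> 0).
  by move=> [sv [w [? [? []]]]]; exists (sv 0), (sv 1).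
apply: (definable_fun_app2 (h := fun x y => x * 2 ^ y)).
(* Adding [2 ^ y] on both sides of [z = x 2 ^ y] leaves only shifts of successors, 1 being the
   successor of 0. *)
apply: (@definable_ext
  (fun v => v 2 + 1 * 2 ^ v 1 = (v 0).+1 * 2 ^ v 1)).
  by move=> v; split=> ?; lia.
apply: definable_eq.
  apply: definable_add; first exact: definable_var.
  exact: (shift_succ (fun=> 0) _ (definable_const _) (definable_var _)).
by apply: shift_succ; apply: definable_var.
Qed.

Lemma definable_pow2 t : definable_fun t -> definable_fun (fun v => 2 ^ t v).
Proof.
move=> deft; apply: definable_ext (definable_mulpow2 (definable_const 1) deft).
by move=> v; rewrite mul1n.
Qed.

Ltac definable_arith := fail.
Ltac definable_rel := fail.

Ltac definability := repeat (cbv beta; first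
  [ assumption
  | match goal with |- definable_fun _ => first
      [ exact: definable_var
      | exact: definable_const
      | apply: definable_succ
      | apply: definable_add
      | apply: definable_mulpow2
      | apply: definable_pow2
      | definable_arith ] end
  | match goal with |- definable _ => first
      [ apply: definable_and
      | apply: definable_ex
      | apply: definable_exf
      | apply: definable_all => ?
      | apply: definable_imply
      | apply: definable_le
      | apply: definable_eq
      | definable_rel ] end ]).

Lemma definable_mul t u :
  definable_fun t -> definable_fun u -> definable_fun (fun v => t v * u v).
Proof.
apply: (definable_fun_app2 (h := muln)).
apply: definable_ext (fun v => mul_small_product (v 0) (v 1) (v 2)) _.
rewrite /small_product; definability.
Qed.

Ltac definable_arith ::= apply: definable_mul.

Lemma definable_exp t u :
  definable_fun t -> definable_fun u -> definable_fun (fun v => t v ^ u v).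
Proof.
apply: (definable_fun_app2 (h := expn)).
apply: definable_ext (fun v => exp_remainder (v 0) (v 1) (v 2)) _.
definability.
Qed.

Ltac definable_arith ::=
  first [apply: definable_mul | apply: definable_exp].

Lemma definable_bitle t u :
  definable_fun t -> definable_fun u -> definable (fun v => bitle (t v) (u v)).
Proof.
apply: (definable_app2 (R := fun x y => bitle x y)).
apply: definable_ext (fun v => bitle_digit (v 0) (v 1)) _.
definability.
Qed.

Lemma definable_mersenne t :
  definable_fun t -> definable_fun (fun v => (2 ^ t v).-1).
Proof.
move=> deft; apply: (@definable_ext (fun v => v 0 + 1 = 2 ^ t (v \o succn))).
  by move=> v; have := expn_gt0 2 (t (v \o succn)); split; lia.
have ? := definable_fun_ren succn deft; definability.
Qed.

Lemma definable_repunit t u :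
  definable_fun t -> definable_fun u ->
  definable_fun (fun v => repunit (2 ^ (t v).+1) (u v)).
Proof.
move=> deft defu; apply: (@definable_ext (fun v =>
  v 0 * 2 ^ (t (v \o succn)).+1 + 1 = v 0 + (2 ^ (t (v \o succn)).+1) ^ u (v \o succn))).
  by move=> v; rewrite repunitP // -{1}(expn0 2) ltn_exp2l.
have ? := definable_fun_ren succn deft; have ? := definable_fun_ren succn defu.
definability.
Qed.

Lemma definable_init t j :
  definable_fun t -> definable_fun (fun v => (init (t v)).2 j).
Proof. by case: j => [//|j] _; apply: definable_const. Qed.

Ltac definable_arith ::= first
  [ apply: definable_mul
  | apply: definable_exp
  | apply: definable_mersenne
  | apply: definable_repunit
  | apply: definable_init
  | apply: definable_dot => ? ].
Ltac definable_rel ::= apply: definable_bitle.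

(** As [P] is fixed, it has finitely many transitions and registers, and the quantifiers over [e]
    and [j] in [history] become finite conjunctions. *)
Lemma definable_halts P : definable (fun v => halts P (v 0)).
Proof.
apply: definable_ext (fun v => halts_history P (v 0)) _.
rewrite /history; definability.
Qed.

End Definability.

Theorem theorem4p2 (Sigma : finType) (c0 c1 : Sigma) (c0_neq_c1 : c0 <> c1) :
  ~ decidable_problem (@code_eform Sigma) (@satisfiable Sigma c0 c1).
Proof.
move=> [P decP]; have [p pP] := definable_halts c0_neq_c1 (diagonal (binstantiate 0) P).
pose n := code_qform p.
have satP : satisfiable c0 c1 (instantiate p n) <-> halts (diagonal (binstantiate 0) P) n.
  split=> [[sv [nv [pnv nvn]]]|].
    have nvE : join (nv \o double) (nv \o odouble) = nv.
      apply: functional_extensionality => i; rewrite /join /=.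
      case: ifP => odd_i; rewrite -[in RHS](odd_double_half i) odd_i //.
    rewrite -[n]nvn; apply/(pP (nv \o double)).
    by exists sv, (nv \o odouble); rewrite nvE.
  move=> /(pP (fun=> n))[sv [w pw]].
  by exists sv, (join (fun=> n) w); split.
have [sat1 unsat0] := decP (instantiate p n).
(* The answer 1 would make the machine loop, against [satP]. So the formula is unsatisfiable, and
   the answer 0 makes the machine halt, again against [satP]. *)
have unsat : ~ satisfiable c0 c1 (instantiate p n).
  move=> sat_p; have [m [R [mE R0]]] := diagonal_computes (sat1 sat_p).
  by apply: (loops_at_stop mE R0); apply/satP.
have [m [R [mE R0]]] := diagonal_computes (unsat0 unsat).
by apply/unsat/satP/(halts_at_stop mE R0).
Qed.
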